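(* For any composition $\alpha$ of $n$, there are $H_n(0)$-module isomorphisms $$\mathcal{V}_\alpha\cong\mathsf{B}(\mathsf{read}(\mathscr{T}_\alpha),\mathsf{read}(\mathscr{T}'_\alpha))\quad\text{and}\quad X_\alpha\cong\mathsf{B}(\mathsf{read}(\mathsf{T}_\alpha),\mathsf{read}(\mathsf{T}'_\alpha)),$$ where the words in the parentheses are viewed as permutations in one-line notation.
   Context: Permutations in $\mathfrak{S}_n$ are composed as functions; $s_i=(i,i+1)$; $\ell$ is the Coxeter length; $\mathrm{Des}_L(\sigma)=\{i\mid \ell(s_i\sigma)<\ell(\sigma)\}$. Left weak Bruhat order: $\sigma\preceq_L\rho$ iff $\rho=\gamma\sigma$ with $\ell(\rho)=\ell(\gamma)+\ell(\sigma)$ for some $\gamma$; $[\sigma,\rho]_L=\{\gamma\mid\sigma\preceq_L\gamma\preceq_L\rho\}$. $H_n(0)$ is the unital $\mathbb{C}$-algebra generated by $\pi_1,\dots,\pi_{n-1}$ with relations $\pi_i^2=\pi_i$, $\pi_i\pi_{i+1}\pi_i=\pi_{i+1}\pi_i\pi_{i+1}$, $\pi_i\pi_j=\pi_j\pi_i$ for $|i-j|\ge2$. $\mathsf{B}(\sigma,\rho)$ is the left $H_n(0)$-module with basis $[\sigma,\rho]_L$ and action: $\pi_i\cdot\gamma=\gamma$ if $i\in\mathrm{Des}_L(\gamma)$; $0$ if $i\notin\mathrm{Des}_L(\gamma)$ and $s_i\gamma\notin[\sigma,\rho]_L$; $s_i\gamma$ if $i\notin\mathrm{Des}_L(\gamma)$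 and $s_i\gamma\in[\sigma,\rho]_L$. The composition diagram of $\alpha=(\alpha_1,\dots,\alpha_k)$ is the left-justified array of boxes whose $i$th row from the top has $\alpha_i$ boxes. A standard immaculate tableau of shape $\alpha$ is a filling of the composition diagram with $1,\dots,n$, all distinct, with rows increasing from left to right and first column increasing from top to bottom; $\mathrm{SIT}(\alpha)$ is the set of these. A standard extended tableau of shape $\alpha$ is such a filling with rows increasing from left to right and every column increasing from top to bottom (over the boxes present); $\mathrm{SET}(\alpha)$ is the set of these. Below, $s_i\cdot T$ is obtained from $T$ by swapping $i$ and $i+1$. $\mathcal{V}_\alpha$ is the $H_n(0)$-module with basis $\mathrm{SIT}(\alpha)$ and action: $\pi_i\cdot\mathscr{T}=\mathscr{T}$ if $i$ is weakly below $i+1$ in $\mathscr{T}$; $0$ if $i$ and $i+1$ are both in the first column; $s_i\cdot\mathscr{T}$ otherwise. (If both are in the first column, $i$ is above $i+1$.) $X_\alpha$ is the $H_n(0)$-module with basis $\mathrm{SET}(\alpha)$ and action: $\pi_i\cdot\mathsf{T}=\mathsf{T}$ if $i$ is strictly left of $i+1$; $0$ if $i$ and $i+1$ are in the same column; $s_i\cdot\mathsf{T}$ if $i$ is strictly right of $i+1$. $\mathscr{T}_\alpha=\mathsf{T}_\alpha$ (the sources) is the filling with $1,2,\dots,n$ from left to right in each row, rows taken from top to bottom. $\mathscr{T}'_\alpha$ (the sink of $\mathrm{SIT}(\alpha)$) is obtained by filling the first column with $1,\dots,k$ from top to bottom and then the remaining boxes with $k+1,\dots,n$ from left to right in each row,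 rows taken from bottom to top. $\mathsf{T}'_\alpha$ (the sink of $\mathrm{SET}(\alpha)$) is the filling with $1,\dots,n$ from top to bottom in each column, columns taken from left to right. For a filling $T$ of a composition diagram, $\mathsf{read}(T)$ is the word obtained by reading the entries of each row from right to left, rows taken from top to bottom. *)

(* Defs.v *)
From HB Require Import structures.
From mathcomp Require Import all_boot all_order all_fingroup all_algebra.
From mathcomp Require Import generic_quotient boolp zify.

Set Implicit Arguments.
Unset Strict Implicit.
Unset Printing Implicit Defensive.

Import GRing.Theory.
Local Open Scope ring_scope.
Local Open Scope quotient_scope.

(* The 0-Hecke algebra H_n(0) over K is given by its presentation: it is the
   quotient of the noncommutative expressions in scalars and generators by the
   smallest congruence containing the laws of unital associative K-algebras and
   the defining relations. The generator index i : 'I_n.-1 is zero-based: it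
   stands for the generator pi_{i+1}, with i + 1 in {1, ..., n - 1}. *)
Inductive hecke_term (K : Type) (n : nat) : Type :=
| TScal of K
| TGen of 'I_n.-1
| TAdd of hecke_term K n & hecke_term K n
| TMul of hecke_term K n & hecke_term K n.
Arguments TScal {K n}.
Arguments TGen {K n}.

Inductive hecke_eq (K : fieldType) (n : nat) :
    hecke_term K n -> hecke_term K n -> Prop :=
| heq_refl x : hecke_eq x x
| heq_sym x y : hecke_eq x y -> hecke_eq y x
| heq_trans x y z : hecke_eq x y -> hecke_eq y z -> hecke_eq x z
| heq_add x x' y y' :
    hecke_eq x x' -> hecke_eq y y' -> hecke_eq (TAdd x y) (TAdd x' y')
| heq_mul x x' y y' :
    hecke_eq x x' -> hecke_eq y y' -> hecke_eq (TMul x y) (TMul x' y')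
| heq_addA x y z : hecke_eq (TAdd x (TAdd y z)) (TAdd (TAdd x y) z)
| heq_addC x y : hecke_eq (TAdd x y) (TAdd y x)
| heq_add0 x : hecke_eq (TAdd (TScal 0) x) x
| heq_addN x : hecke_eq (TAdd (TMul (TScal (-1)) x) x) (TScal 0)
| heq_mulA x y z : hecke_eq (TMul x (TMul y z)) (TMul (TMul x y) z)
| heq_mul1l x : hecke_eq (TMul (TScal 1) x) x
| heq_mul1r x : hecke_eq (TMul x (TScal 1)) x
| heq_mulDl x y z : hecke_eq (TMul (TAdd x y) z) (TAdd (TMul x z) (TMul y z))
| heq_mulDr x y z : hecke_eq (TMul x (TAdd y z)) (TAdd (TMul x y) (TMul x z))
| heq_scalD a b : hecke_eq (TScal (a + b)) (TAdd (TScal a) (TScal b))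
| heq_scalM a b : hecke_eq (TScal (a * b)) (TMul (TScal a) (TScal b))
| heq_scalC a x : hecke_eq (TMul (TScal a) x) (TMul x (TScal a))
| heq_idem i : hecke_eq (TMul (TGen i) (TGen i)) (TGen i)
| heq_braid (i j : 'I_n.-1) : j = i.+1 :> nat ->
    hecke_eq (TMul (TGen i) (TMul (TGen j) (TGen i)))
             (TMul (TGen j) (TMul (TGen i) (TGen j)))
| heq_comm (i j : 'I_n.-1) : (i.+1 < j)%N ->
    hecke_eq (TMul (TGen i) (TGen j)) (TMul (TGen j) (TGen i)).

HB.instance Definition _ (K : Type) (n : nat) := gen_eqMixin (hecke_term K n).
HB.instance Definition _ (K : Type) (n : nat) :=
  gen_choiceMixin (hecke_term K n).

Section HeckeAlgebra.
Variables (K : fieldType) (n : nat).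
Implicit Types s t : hecke_term K n.

Definition hecke_eqb s t : bool := `[< hecke_eq s t >].

Lemma hecke_eqb_refl : reflexive hecke_eqb.
Proof. by move=> x; apply/asboolP/heq_refl. Qed.

Lemma hecke_eqb_sym : symmetric hecke_eqb.
Proof. by move=> x y; apply/asboolP/asboolP; apply: heq_sym. Qed.

Lemma hecke_eqb_trans : transitive hecke_eqb.
Proof.
move=> y x z /asboolP xy /asboolP yz; apply/asboolP; exact: heq_trans xy yz.
Qed.

Canonical hecke_equiv :=
  EquivRel hecke_eqb hecke_eqb_refl hecke_eqb_sym hecke_eqb_trans.

Definition hecke_alg := {eq_quot hecke_equiv}.
HB.instance Definition _ := Choice.on hecke_alg.

Definition hclass (t : hecke_term K n) : hecke_alg := \pi_hecke_alg t.

Lemma hclassP s t : hclass s = hclass t <-> hecke_eq s t.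
Proof. by split => [/eqmodP/asboolP|st] //; apply/eqmodP/asboolP. Qed.

Lemma hclass_repr (x : hecke_alg) : hclass (repr x) = x.
Proof. exact: reprK. Qed.

Lemma repr_hclass t : hecke_eq (repr (hclass t)) t.
Proof. by apply/hclassP; rewrite hclass_repr. Qed.

Definition hadd (x y : hecke_alg) := hclass (TAdd (repr x) (repr y)).
Definition hmul (x y : hecke_alg) := hclass (TMul (repr x) (repr y)).
Definition hopp (x : hecke_alg) := hclass (TMul (TScal (-1)) (repr x)).

Lemma haddE s t : hadd (hclass s) (hclass t) = hclass (TAdd s t).
Proof. by apply/hclassP/heq_add; apply: repr_hclass. Qed.

Lemma hmulE s t : hmul (hclass s) (hclass t) = hclass (TMul s t).
Proof. by apply/hclassP/heq_mul; apply: repr_hclass. Qed.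

Lemma hoppE t : hopp (hclass t) = hclass (TMul (TScal (-1)) t).
Proof. by apply/hclassP/heq_mul; [apply: heq_refl|apply: repr_hclass]. Qed.

Lemma hadd_assoc : associative hadd.
Proof.
move=> x y z; rewrite -[x]hclass_repr -[y]hclass_repr -[z]hclass_repr.
by rewrite !haddE; apply/hclassP/heq_addA.
Qed.

Lemma hadd_comm : commutative hadd.
Proof. by move=> x y; apply/hclassP/heq_addC. Qed.

Lemma hadd_0 : left_id (hclass (TScal 0)) hadd.
Proof.
by move=> x; rewrite -[x]hclass_repr haddE; apply/hclassP/heq_add0.
Qed.

Lemma hadd_opp : left_inverse (hclass (TScal 0)) hopp hadd.
Proof.
by move=> x; rewrite -[x]hclass_repr hoppE haddE; apply/hclassP/heq_addN.
Qed.

HB.instance Definition _ :=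
  GRing.isZmodule.Build hecke_alg hadd_assoc hadd_comm hadd_0 hadd_opp.

Lemma hmul_assoc : associative hmul.
Proof.
move=> x y z; rewrite -[x]hclass_repr -[y]hclass_repr -[z]hclass_repr.
by rewrite !hmulE; apply/hclassP/heq_mulA.
Qed.

Lemma hmul_1l : left_id (hclass (TScal 1)) hmul.
Proof. by move=> x; rewrite -[x]hclass_repr hmulE; apply/hclassP/heq_mul1l. Qed.

Lemma hmul_1r : right_id (hclass (TScal 1)) hmul.
Proof. by move=> x; rewrite -[x]hclass_repr hmulE; apply/hclassP/heq_mul1r. Qed.

Lemma hmul_Dl : left_distributive hmul hadd.
Proof.
move=> x y z; rewrite -[x]hclass_repr -[y]hclass_repr -[z]hclass_repr.
by rewrite !(haddE, hmulE); apply/hclassP/heq_mulDl.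
Qed.

Lemma hmul_Dr : right_distributive hmul hadd.
Proof.
move=> x y z; rewrite -[x]hclass_repr -[y]hclass_repr -[z]hclass_repr.
by rewrite !(haddE, hmulE); apply/hclassP/heq_mulDr.
Qed.

End HeckeAlgebra.

Section Evaluation.
Variables (K : fieldType) (n : nat) (V : lmodType K).
Variable p : 'I_n.-1 -> V -> V.
Hypothesis p_lin : forall i, linear (p i).
Hypothesis p_idem : forall i v, p i (p i v) = p i v.
Hypothesis p_braid : forall i j : 'I_n.-1, j = i.+1 :> nat ->
  forall v, p i (p j (p i v)) = p j (p i (p j v)).
Hypothesis p_comm : forall i j : 'I_n.-1, (i.+1 < j)%N ->
  forall v, p i (p j v) = p j (p i v).

Fixpoint heval (t : hecke_term K n) (v : V) : V :=
  match t with
  | TScal a => a *: v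
  | TGen i => p i v
  | TAdd s t => heval s v + heval t v
  | TMul s t => heval s (heval t v)
  end.

Lemma heval_lin t : linear (heval t).
Proof.
elim: t => [a|i|s IHs t IHt|s IHs t IHt] c u v //=.
- by rewrite scalerDr !scalerA mulrC.
- exact: p_lin.
- by rewrite IHs IHt scalerDr addrACA.
- by rewrite IHt IHs.
Qed.

Lemma hevalD t u v : heval t (u + v) = heval t u + heval t v.
Proof. by have := heval_lin t 1 u v; rewrite !scale1r. Qed.

Lemma heval0 t : heval t 0 = 0.
Proof. by have /eqP := hevalD t 0 0; rewrite addr0 -subr_eq subrr => /eqP. Qed.

Lemma hevalZ t a v : heval t (a *: v) = a *: heval t v.
Proof. by have := heval_lin t a v 0; rewrite heval0 !addr0. Qed.

Lemma heval_eq s t : hecke_eq s t -> forall v, heval s v = heval t v.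
Proof.
elim=> //=.
- by move=> x y z _ xy _ yz v; rewrite xy yz.
- by move=> x x' y y' _ xx' _ yy' v; rewrite xx' yy'.
- by move=> x x' y y' _ xx' _ yy' v; rewrite xx' yy'.
- by move=> x y z v; rewrite addrA.
- by move=> x y v; rewrite addrC.
- by move=> x v; rewrite scale0r add0r.
- by move=> x v; rewrite scaleN1r addNr scale0r.
- by move=> x v; rewrite scale1r.
- by move=> x v; rewrite scale1r.
- by move=> x y z v; rewrite hevalD.
- by move=> a b v; rewrite scalerDl.
- by move=> a b v; rewrite scalerA.
- by move=> a x v; rewrite hevalZ.
Qed.

Lemma heval_repr t v : heval (repr (hclass t)) v = heval t v.
Proof. exact/heval_eq/repr_hclass. Qed.

End Evaluation.

Section HeckeRing.
Variables (K : fieldType) (n : nat).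
Local Notation H := (hecke_alg K n).

Lemma hecke_oner_neq0 : hclass (TScal 1) != 0 :> H.
Proof.
apply/eqP => /hclassP e01.
have := @heval_eq K n K^o (fun _ v => v) (fun _ _ _ _ => erefl)
  (fun _ _ => erefl) (fun _ _ _ _ => erefl) (fun _ _ _ _ => erefl) _ _ e01 1.
by rewrite /= scale1r scale0r => /eqP; rewrite oner_eq0.
Qed.

HB.instance Definition _ := GRing.Zmodule_isNzRing.Build H
  (@hmul_assoc K n) (@hmul_1l K n) (@hmul_1r K n) (@hmul_Dl K n)
  (@hmul_Dr K n) hecke_oner_neq0.

Lemma hclassM s t : hclass s * hclass t = hclass (TMul s t) :> H.
Proof. exact: hmulE. Qed.

Lemma hclassD s t : hclass s + hclass t = hclass (TAdd s t) :> H.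
Proof. exact: haddE. Qed.

Definition hscale (a : K) (x : H) : H := hclass (TScal a) * x.

Lemma hscaleA a b x : hscale a (hscale b x) = hscale (a * b) x.
Proof.
rewrite /hscale mulrA; congr (_ * _).
by rewrite hclassM; apply/esym/hclassP/heq_scalM.
Qed.

Lemma hscale1 : left_id 1 hscale.
Proof. exact: mul1r. Qed.

Lemma hscaleDr : right_distributive hscale +%R.
Proof. by move=> a x y; apply: mulrDr. Qed.

Lemma hscaleDl x : {morph hscale^~ x : a b / a + b}.
Proof.
move=> a b; rewrite /hscale -mulrDl; congr (_ * _).
by rewrite hclassD; apply/hclassP/heq_scalD.
Qed.

HB.instance Definition _ := GRing.Zmodule_isLmodule.Build K H
  hscaleA hscale1 hscaleDr hscaleDl.

Lemma hscaleAl (a : K) (x y : H) : a *: (x * y) = (a *: x) * y.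
Proof. exact: mulrA. Qed.

HB.instance Definition _ := GRing.Lmodule_isLalgebra.Build K H hscaleAl.

Lemma hscaleAr (a : K) (x y : H) : a *: (x * y) = x * (a *: y).
Proof.
rewrite [LHS]mulrA [RHS]mulrA; congr (_ * _).
rewrite -[x]hclass_repr !hclassM; exact/hclassP/heq_scalC.
Qed.

HB.instance Definition _ := GRing.Lalgebra_isAlgebra.Build K H hscaleAr.

Definition hgen (i : 'I_n.-1) : H := hclass (TGen i).

Lemma hgen_idem i : hgen i * hgen i = hgen i.
Proof. by rewrite hclassM; apply/hclassP/heq_idem. Qed.

Lemma hgen_braid (i j : 'I_n.-1) : j = i.+1 :> nat ->
  hgen i * hgen j * hgen i = hgen j * hgen i * hgen j.
Proof.
move=> ij; rewrite -!mulrA /hgen (hclassM (TGen i)) (hclassM (TGen j)) !hclassM.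
by apply/hclassP; apply: heq_braid.
Qed.

Lemma hgen_comm (i j : 'I_n.-1) : (i.+1 < j)%N ->
  hgen i * hgen j = hgen j * hgen i.
Proof. by move=> ij; rewrite !hclassM; apply/hclassP; exact: heq_comm. Qed.

End HeckeRing.

(* An action of the generators on the set T, where None stands for 0. *)
Record hecke_action (n : nat) (T : finType) := HeckeAction {
  hact :> 'I_n.-1 -> T -> option T;
  hact_idem : forall i t, obind (hact i) (hact i t) = hact i t;
  hact_braid : forall i j : 'I_n.-1, j = i.+1 :> nat -> forall t,
    obind (hact i) (obind (hact j) (hact i t)) =
    obind (hact j) (obind (hact i) (hact j t));
  hact_comm : forall i j : 'I_n.-1, (i.+1 < j)%N -> forall t,
    obind (hact i) (hact j t) = obind (hact j) (hact i t) }.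

(* The module with basis T on which the generators act through a: its elements
   are the coordinate families of linear combinations of elements of T. *)
Definition basis_mod (K : fieldType) (n : nat) (T : finType)
  (a : hecke_action n T) : Type := {ffun T -> K}.

Section BasisModule.
Variables (K : fieldType) (n : nat) (T : finType) (a : hecke_action n T).
Local Notation V := {ffun T -> K^o}.

Definition bvec (t : T) : V := [ffun u => (u == t)%:R].
Definition bvec0 (o : option T) : V := oapp bvec 0 o.
Definition bgen (i : 'I_n.-1) (v : V) : V := \sum_t v t *: bvec0 (a i t).

Lemma bgen_lin i : linear (bgen i).
Proof.
move=> c u v; rewrite /bgen scaler_sumr -big_split /=; apply: eq_bigr => t _.
by rewrite !ffunE scalerDl scalerA.
Qed.

HB.instance Definition _ i := GRing.isLinear.Build K V V _ (bgen i) (bgen_lin i).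

Lemma bgen_bvec i t : bgen i (bvec t) = bvec0 (a i t).
Proof.
rewrite /bgen (bigD1 t) //= ffunE eqxx scale1r big1 ?addr0 // => u /negPf ut.
by rewrite ffunE ut scale0r.
Qed.

Lemma bgen_bvec0 i o : bgen i (bvec0 o) = bvec0 (obind (a i) o).
Proof. by case: o => [t|] /=; rewrite ?bgen_bvec // linear0. Qed.

Lemma bvec_decomp (v : V) : v = \sum_t v t *: bvec t.
Proof.
apply/ffunP => u; rewrite sum_ffunE (bigD1 u) //= !ffunE eqxx.
rewrite big1 => [|t /negPf tu]; first by rewrite addr0 /GRing.scale /= mulr1.
by rewrite !ffunE eq_sym tu scaler0.
Qed.

Lemma bvec_ext (f g : V -> V) : linear f -> linear g ->
  (forall t, f (bvec t) = g (bvec t)) -> f =1 g.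
Proof.
move=> flin glin fg v.
pose F := GRing.isLinear.Build K V V _ f flin.
pose G := GRing.isLinear.Build K V V _ g glin.
pose f' : {linear V -> V} := HB.pack f F.
pose g' : {linear V -> V} := HB.pack g G.
rewrite -[f v]/(f' v) -[g v]/(g' v) [v]bvec_decomp !linear_sum.
by apply: eq_bigr => t _; rewrite !linearZ /= fg.
Qed.

Lemma bgen_idem i v : bgen i (bgen i v) = bgen i v.
Proof.
move: v; apply: (@bvec_ext (bgen i \o bgen i)) => [c u v|c u v|t] /=.
- by rewrite !linearP.
- by rewrite !linearP.
- by rewrite bgen_bvec bgen_bvec0 hact_idem.
Qed.

Lemma bgen_braid (i j : 'I_n.-1) : j = i.+1 :> nat ->
  forall v, bgen i (bgen j (bgen i v)) = bgen j (bgen i (bgen j v)).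
Proof.
move=> ij; apply: (@bvec_ext (bgen i \o (bgen j \o bgen i))
  (bgen j \o (bgen i \o bgen j))) => [c u v|c u v|t] /=.
- by rewrite !linearP.
- by rewrite !linearP.
- by rewrite !bgen_bvec !bgen_bvec0 hact_braid.
Qed.

Lemma bgen_comm (i j : 'I_n.-1) : (i.+1 < j)%N ->
  forall v, bgen i (bgen j v) = bgen j (bgen i v).
Proof.
move=> ij; apply: (@bvec_ext (bgen i \o bgen j)
  (bgen j \o bgen i)) => [c u v|c u v|t] /=.
- by rewrite !linearP.
- by rewrite !linearP.
- by rewrite !bgen_bvec !bgen_bvec0 hact_comm.
Qed.

HB.instance Definition _ := GRing.Zmodule.copy (basis_mod K a) V.
Local Notation M := (basis_mod K a).

Definition bscale (x : hecke_alg K n) (v : M) : M :=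
  heval bgen (repr x) v.

Let evE := heval_eq bgen_lin bgen_idem bgen_braid bgen_comm.

Lemma bscale_hclass t v : bscale (hclass t) v = heval bgen t v.
Proof. exact/evE/repr_hclass. Qed.

Lemma bscaleA x y v : bscale x (bscale y v) = bscale (x * y) v.
Proof. by rewrite -[x]hclass_repr -[y]hclass_repr hclassM !bscale_hclass. Qed.

Lemma bscale1 : left_id 1 bscale.
Proof. by move=> v; rewrite bscale_hclass; apply: (@scale1r K V). Qed.

Lemma bscaleDr : right_distributive bscale +%R.
Proof. by move=> x u v; apply: (hevalD bgen_lin). Qed.

Lemma bscaleDl v : {morph bscale^~ v : x y / x + y}.
Proof.
by move=> x y; rewrite -[x]hclass_repr -[y]hclass_repr hclassD !bscale_hclass.
Qed.

HB.instance Definition _ :=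
  GRing.Zmodule_isLmodule.Build (hecke_alg K n) M
    bscaleA bscale1 bscaleDr bscaleDl.

Definition basis_elt (t : T) : M := bvec t.

Lemma hgen_basis_elt i t :
  hgen K i *: basis_elt t = if a i t is Some u then basis_elt u else 0.
Proof. by rewrite [LHS]bscale_hclass /= bgen_bvec; case: (a i t). Qed.

Lemma scalar_basis_mod (c : K) (v : M) t :
  ((c%:A : hecke_alg K n) *: v) t = c * v t.
Proof.
have -> : c%:A = hclass (TScal c) :> hecke_alg K n.
  by rewrite [LHS]hmulE; apply/hclassP/heq_mul1r.
by rewrite [_ *: _]bscale_hclass /= ffunE.
Qed.

End BasisModule.
Arguments basis_elt K {n T} a t.

(* Linear maps over hecke_alg K n are in particular K-linear, since the scalars
   of K are elements of hecke_alg K n. *)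
Definition hecke_iso (K : fieldType) (n : nat) (M N : lmodType (hecke_alg K n)) :
  Prop := exists f : {linear M -> N}, bijective f.

Section Transfer.
Variables (T : Type) (P : pred T) (S : subType P) (f : S -> option S).
Variables (f' : T -> option T).
Hypothesis ff' : forall t, omap val (f t) = f' (val t).

Lemma omap_val_inj : injective (omap (val : S -> T)).
Proof. by move=> [x|] [y|] //= [/val_inj->]. Qed.

Lemma omap_val_obind o : omap (val : S -> T) (obind f o) = obind f' (omap val o).
Proof. by case: o => //= t. Qed.

End Transfer.

Local Open Scope nat_scope.

Section IntervalAction.
Variables (T : Type) (I : pred T) (le : rel T).
Hypothesis le_tr : forall y x z, le x y -> le y z -> le x z.
Hypothesis convex : forall x y z, I x -> le x y -> le y z -> I z -> I y.

Definition interval_act (D : pred T) (u : T -> T) (x : T) : option T :=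
  if D x then Some x else if I (u x) then Some (u x) else None.

Variables (D E : pred T) (u v : T -> T).
Hypothesis le_u : forall x, ~~ D x -> le x (u x).
Hypothesis le_v : forall x, ~~ E x -> le x (v x).

Lemma interval_act_comm x :
  (forall y, D (v y) = D y) -> (forall y, E (u y) = E y) ->
  v (u x) = u (v x) -> I x ->
  obind (interval_act D u) (interval_act E v x) =
  obind (interval_act E v) (interval_act D u x).
Proof.
move=> Dv Eu uv Ix; rewrite /interval_act.
case: (boolP (D x)) => Dx; case: (boolP (E x)) => Ex /=.
- by rewrite Dx Ex.
- by rewrite (negPf Ex); case: ifP; rewrite //= Dv Dx.
- by rewrite (negPf Dx); case: ifP; rewrite //= Eu Ex.
have luv : le (v x) (u (v x)) by apply: le_u; rewrite Dv.
have lvu : le (u x) (u (v x)) by rewrite -uv; apply: le_v; rewrite Eu.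
case: (boolP (I (u (v x)))) => [top|/negPf top].
  rewrite (convex Ix (le_v Ex) luv top) (convex Ix (le_u Dx) lvu top) /=.
  by rewrite Dv Eu (negPf Dx) (negPf Ex) uv top.
case: (I (v x)); case: (I (u x)) => //=;
  by rewrite ?Dv ?Eu ?(negPf Dx) ?(negPf Ex) ?uv ?top.
Qed.

Lemma interval_act_braid (a b c : T -> nat) x :
  (forall y, D y = (b y < a y)) -> (forall y, E y = (c y < b y)) ->
  (forall y, [/\ a (u y) = b y, b (u y) = a y & c (u y) = c y]) ->
  (forall y, [/\ a (v y) = a y, b (v y) = c y & c (v y) = b y]) ->
  u (v (u x)) = v (u (v x)) -> [&& a x != b x, a x != c x & b x != c x] ->
  I x ->
  obind (interval_act D u) (obind (interval_act E v) (interval_act D u x)) =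
  obind (interval_act E v) (obind (interval_act D u) (interval_act E v x)).
Proof.
move=> Dab Ebc uE vE braid /and3P[ab ac bc] Ix.
have au y : a (u y) = b y by case: (uE y).
have bu y : b (u y) = a y by case: (uE y).
have cu y : c (u y) = c y by case: (uE y).
have av y : a (v y) = a y by case: (vE y).
have bv y : b (v y) = c y by case: (vE y).
have cv y : c (v y) = b y by case: (vE y).
have lu y : (b y < a y) = false -> le y (u y).
  by move=> Dy; apply: le_u; rewrite Dab Dy.
have lv y : (c y < b y) = false -> le y (v y).
  by move=> Ey; apply: le_v; rewrite Ebc Ey.
pose F := (Dab, Ebc, au, bu, cu, av, bv, cv).
move: ab ac bc; rewrite /interval_act.
case: (ltngtP (a x) (b x)) => // ab _; case: (ltngtP (a x) (c x)) => // ac _;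
  case: (ltngtP (b x) (c x)) => // bc _; try (by exfalso; lia).
all: have ab' := leq_gtF (ltnW ab); have ac' := leq_gtF (ltnW ac).
all: have bc' := leq_gtF (ltnW bc).
all: pose G := (F, ab, ac, bc, ab', ac', bc').
all: rewrite /= !G /= ?G.
2-6: rewrite /= ?G /= ?G /= ?G /=.
2-6: by do 6?[case: ifP => e /=; rewrite ?e //= ?G ?e //= ?G ?e /=; clear e].
have [lx ly] := (lu x ab', lv x bc').
have l1 : le (u x) (v (u x)) by apply: lv; rewrite !F.
have l2 : le (v (u x)) (u (v (u x))) by apply: lu; rewrite !F.
have l3 : le (v x) (u (v x)) by apply: lu; rewrite !F.
have l4 : le (u (v x)) (u (v (u x))) by rewrite braid; apply: lv; rewrite !F.
have top : I (u (v (u x))) -> [&& I (u x), I (v (u x)), I (v x) & I (u (v x))].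
  move=> It; rewrite (convex Ix lx (le_tr l1 l2) It).
  rewrite (convex Ix (le_tr lx l1) l2 It) (convex Ix ly (le_tr l3 l4) It).
  by rewrite (convex Ix (le_tr ly l3) l4 It).
case It: (I (u (v (u x)))).
  have /and4P[I1 I2 I3 I4] := top It.
  rewrite I1 I3 /= !G /= I2 I4 /= !G /= It -braid It.
  done.
move: (It); rewrite braid => It'.
case I1: (I (u x)); case I3: (I (v x)); rewrite /= ?G /=.
all: case I2: (I (v (u x))); case I4: (I (u (v x))); rewrite /= ?G /= ?It ?It' //.
Qed.

End IntervalAction.

Section Permutations.
Variable n : nat.
Implicit Types (s t g : 'S_n) (i j : 'I_n.-1).

(* The product of 'S_n satisfies (s * t) x = t (s x): composition of functions
   is the opposite product. *)
Definition pcomp s t : 'S_n := (t * s)%g.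

Lemma pcompE s t x : pcomp s t x = s (t x).
Proof. exact: permM. Qed.

Lemma index_hi_subproof i : i.+1 < n.
Proof. by have := ltn_ord i; lia. Qed.

Definition lo i : 'I_n := widen_ord (leq_pred n) i.
Definition hi i : 'I_n := Ordinal (index_hi_subproof i).

Definition simple_refl i : 'S_n := tperm (lo i) (hi i).

Definition refl_word (w : seq 'I_n.-1) : 'S_n :=
  foldr (fun i g => pcomp (simple_refl i) g) 1%g w.

Definition inversions g : {set 'I_n * 'I_n} :=
  [set p : 'I_n * 'I_n | (p.1 < p.2) && (g p.2 < g p.1)].

Lemma lo_neq_hi i : lo i != hi i.
Proof. by rewrite -val_eqE /=; lia. Qed.

Lemma simple_reflK i g : pcomp (simple_refl i) (pcomp (simple_refl i) g) = g.
Proof. by rewrite /pcomp -mulgA tperm2 mulg1. Qed.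

Lemma pcomp_refl_inv i g x :
  ((pcomp (simple_refl i) g)^-1 x = g^-1 (simple_refl i x))%g.
Proof. by rewrite /pcomp invMg tpermV permM. Qed.

Lemma inversions_up i g : (g^-1 (lo i) < g^-1 (hi i))%g ->
  #|inversions (pcomp (simple_refl i) g)| = #|inversions g|.+1.
Proof.
set a := (g^-1 _)%g; set b := (g^-1 _)%g => ltab.
have ga : g a = lo i by rewrite permKV.
have gb : g b = hi i by rewrite permKV.
have -> : inversions (pcomp (simple_refl i) g) = (a, b) |: inversions g.
  apply/setP => -[x y]; rewrite !inE /= xpair_eqE !pcompE.
  rewrite -(inj_eq (@perm_inj _ g) x) -(inj_eq (@perm_inj _ g) y) ga gb.
  have [xy|] := ltnP x y; last first.
    move=> yx /=; apply/esym/negbTE/negP; rewrite orbF -ga -gb.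
    by rewrite !(inj_eq (@perm_inj _ g)) => /andP[/eqP xa /eqP yb]; move: yx; rewrite xa yb; lia.
  have : ~~ ((g x == hi i) && (g y == lo i)).
    rewrite -ga -gb !(inj_eq (@perm_inj _ g)).
    by apply/negP => /andP[/eqP xa /eqP yb]; move: xy; rewrite xa yb; lia.
  have nxy : (g x != g y) by apply: contraTneq xy => /perm_inj->; rewrite ltnn.
  move: nxy; rewrite /simple_refl !permE /= -!val_eqE /=.
  by do ![case: ifP => /=]; lia.
by rewrite cardsU1 inE /= ltab ga gb /= ltnNge leqW.
Qed.

Lemma inversions_down i g : (g^-1 (hi i) < g^-1 (lo i))%g ->
  #|inversions g| = #|inversions (pcomp (simple_refl i) g)|.+1.
Proof.
move=> lt; rewrite -(@inversions_up i) ?simple_reflK //.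
by rewrite !pcomp_refl_inv tpermL tpermR.
Qed.

Lemma inv_total i g : ~~ (g^-1 (hi i) < g^-1 (lo i))%g ->
  (g^-1 (lo i) < g^-1 (hi i))%g.
Proof.
have : (g^-1 (hi i) != g^-1 (lo i))%g.
  by rewrite (inj_eq (@perm_inj _ _)) eq_sym lo_neq_hi.
by rewrite -val_eqE /=; lia.
Qed.

Lemma no_descent_eq1 g :
  (forall i, (g^-1 (lo i) < g^-1 (hi i))%g) -> g = 1%g.
Proof.
move=> nd; apply: invg_inj; rewrite invg1; apply/permP => x; rewrite perm1.
have up k (kn : k < n) : k <= (g^-1)%g (Ordinal kn).
  elim: k kn => [|k IHk] kn; first exact: leq0n.
  have kn' : k < n.-1 by lia.
  have := nd (Ordinal kn'); have := IHk (ltnW kn).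
  have -> : Ordinal (ltnW kn) = lo (Ordinal kn') by apply: val_inj.
  have -> : Ordinal kn = hi (Ordinal kn') by apply: val_inj.
  by lia.
have down d (y : 'I_n) : y + d = n.-1 -> (g^-1)%g y + d <= n.-1.
  elim: d y => [|d IHd] y yd; first by have := ltn_ord ((g^-1)%g y); lia.
  have yn : y < n.-1 by lia.
  have := nd (Ordinal yn); have := IHd (hi (Ordinal yn)).
  have -> : lo (Ordinal yn) = y by apply: val_inj.
  by move=> /=; lia.
apply: ord_inj; have := up _ (ltn_ord x); have := down (n.-1 - x) x.
rewrite subnKC => [/(_ erefl)|]; last by have := ltn_ord x; lia.
have -> : Ordinal (ltn_ord x) = x by apply: val_inj.
by move: (nat_of_ord _) (nat_of_ord x) (ltn_ord x) => u v; lia.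
Qed.

Lemma inversions1 : #|inversions 1| = 0.
Proof.
by apply: eq_card0 => p; rewrite !inE !perm1; apply/negbTE/negP; lia.
Qed.

Lemma inversions_refl_word w : #|inversions (refl_word w)| <= size w.
Proof.
elim: w => [|i w IHw]; first by rewrite inversions1.
rewrite /=; set g := refl_word w in IHw *.
case: (boolP ((g^-1 (hi i) < g^-1 (lo i))%g)) => [di|/inv_total/inversions_up->//].
by move: IHw; rewrite (inversions_down di) => /ltnW/leqW.
Qed.

Lemma refl_word_ex g : exists2 w, refl_word w = g & size w = #|inversions g|.
Proof.
move k: #|inversions g| => m; elim: m g k => [|m IHm] g gm.
  exists [::] => //; apply/esym/no_descent_eq1 => i; apply: inv_total.
  by apply/negP => /inversions_down; rewrite gm.
case: (boolP [exists i, (g^-1 (hi i) < g^-1 (lo i))%g]) => [/existsP[i di]|].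
  have [|w gw sw] := IHm (pcomp (simple_refl i) g).
    by apply: succn_inj; rewrite -gm -inversions_down.
  by exists (i :: w); rewrite /= ?gw ?simple_reflK ?sw.
rewrite negb_exists => /forallP nd.
suff g1 : g = 1%g by rewrite g1 inversions1 in gm.
by apply: no_descent_eq1 => i; apply: inv_total.
Qed.

Lemma coxeter_word_ex g :
  exists k, [exists w : k.-tuple 'I_n.-1, refl_word w == g].
Proof.
have [w gw sw] := refl_word_ex g; exists (size w).
by apply/existsP; exists (in_tuple w); rewrite /= gw.
Qed.

Definition coxeter_length g : nat := ex_minn (coxeter_word_ex g).

Lemma coxeter_lengthE g : coxeter_length g = #|inversions g|.
Proof.
rewrite /coxeter_length; case: ex_minnP => k /existsP[w /eqP gw] mink.
apply/eqP; rewrite eqn_leq; apply/andP; split; last first.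
  by rewrite -gw -{2}(size_tuple w) inversions_refl_word.
have [v gv sv] := refl_word_ex g; apply: mink; rewrite -sv.
by apply/existsP; exists (in_tuple v); rewrite /= gv.
Qed.

Definition DesL g : {set 'I_n.-1} :=
  [set i | coxeter_length (pcomp (simple_refl i) g) < coxeter_length g].

Lemma in_DesL i g : (i \in DesL g) = (g^-1 (hi i) < g^-1 (lo i))%g.
Proof.
rewrite inE !coxeter_lengthE.
case: (boolP ((g^-1 (hi i) < g^-1 (lo i))%g)) => [/inversions_down->|/inv_total/inversions_up->].
  by rewrite ltnSn.
by rewrite ltnNge leqnSn.
Qed.

Definition weak_le s t : bool :=
  [exists g, (t == pcomp g s)
             && (coxeter_length t == coxeter_length g + coxeter_length s)].

Lemma refl_word_cat v w : refl_word (v ++ w) = pcomp (refl_word v) (refl_word w).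
Proof.
elim: v => [|i v IHv] /=; first by rewrite /pcomp mulg1.
by rewrite IHv /pcomp mulgA.
Qed.

Lemma coxeter_length_pcomp s t :
  coxeter_length (pcomp s t) <= coxeter_length s + coxeter_length t.
Proof.
have [v sv lv] := refl_word_ex s; have [w tw lw] := refl_word_ex t.
rewrite !coxeter_lengthE -lv -lw -size_cat -{1}sv -{1}tw -refl_word_cat.
exact: inversions_refl_word.
Qed.

Lemma weak_le_trans t s r : weak_le s t -> weak_le t r -> weak_le s r.
Proof.
move=> /existsP[g /andP[/eqP tg /eqP lt]] /existsP[h /andP[/eqP rh /eqP lr]].
have rgh : r = pcomp (pcomp h g) s by rewrite rh tg /pcomp mulgA.
apply/existsP; exists (pcomp h g); rewrite -rgh eqxx /=.
have := coxeter_length_pcomp h g; have := coxeter_length_pcomp (pcomp h g) s.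
by rewrite -rgh; lia.
Qed.

Lemma weak_le_up i g : i \notin DesL g -> weak_le g (pcomp (simple_refl i) g).
Proof.
move=> di; apply/existsP; exists (simple_refl i); rewrite eqxx /=.
have := coxeter_length_pcomp (simple_refl i) g.
have : coxeter_length (simple_refl i) <= 1.
  have -> : simple_refl i = refl_word [:: i] by rewrite /= /pcomp mul1g.
  by rewrite coxeter_lengthE inversions_refl_word.
by move: di; rewrite in_DesL !coxeter_lengthE => /inv_total/inversions_up->; lia.
Qed.

Lemma simple_refl_id i x : x != lo i -> x != hi i -> simple_refl i x = x.
Proof. by rewrite ![x == _]eq_sym; apply: tpermD. Qed.

Lemma simple_refl_comm i j g : i.+1 < j ->
  pcomp (simple_refl j) (pcomp (simple_refl i) g) =
  pcomp (simple_refl i) (pcomp (simple_refl j) g).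
Proof.
move=> ij; rewrite /pcomp -!mulgA; congr (_ * _)%g.
rewrite conjgC; congr (_ * _)%g; rewrite tpermJ !simple_refl_id //.
all: by rewrite -val_eqE /=; lia.
Qed.

Lemma simple_refl_braid i j g : j = i.+1 :> nat ->
  pcomp (simple_refl i) (pcomp (simple_refl j) (pcomp (simple_refl i) g)) =
  pcomp (simple_refl j) (pcomp (simple_refl i) (pcomp (simple_refl j) g)).
Proof.
move=> ij; rewrite /pcomp -!mulgA; congr (_ * _)%g.
have hl : hi i = lo j by apply: val_inj; rewrite /= ij.
have E k l : (simple_refl k * (simple_refl l * simple_refl k) =
  simple_refl l ^ simple_refl k)%g by rewrite conjgE tpermV.
rewrite !E !tpermJ; congr tperm.
- by rewrite -hl tpermR simple_refl_id // -val_eqE /=; lia.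
- by rewrite hl tpermL simple_refl_id // -val_eqE /=; lia.
Qed.

Definition weak_interval s t : {set 'S_n} := [set g | weak_le s g && weak_le g t].

Section BAction.
Variables s t : 'S_n.
Local Notation I := (weak_interval s t).

(* insub is None exactly outside the interval. *)
Definition b_fun i (g : {g | g \in I}) : option {g | g \in I} :=
  if i \in DesL (val g) then Some g else insub (pcomp (simple_refl i) (val g)).

Let b_funE i x : omap val (b_fun i x) =
  interval_act (mem I) [pred g | i \in DesL g] (pcomp (simple_refl i)) (val x).
Proof.
rewrite /b_fun /interval_act /=; case: ifP => // _.
by case: insubP => [h hI /= ->|/negPf /= ->] //; rewrite ifT.
Qed.

Let convex g1 g2 g3 : mem I g1 -> weak_le g1 g2 -> weak_le g2 g3 -> mem I g3 ->
  mem I g2.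
Proof.
rewrite /= !inE => /andP[sg _] g12 g23 /andP[_ gt].
by rewrite (weak_le_trans sg g12) (weak_le_trans g23 gt).
Qed.

Let weak_le_tr : transitive weak_le.
Proof. by move=> ? ? ?; apply: weak_le_trans. Qed.

Lemma b_fun_idem i x : obind (b_fun i) (b_fun i x) = b_fun i x.
Proof.
apply: omap_val_inj; rewrite (omap_val_obind (b_funE i)) b_funE /interval_act.
case: ifP => [/= di|di]; first by rewrite di.
case: ifP => //= _; rewrite ifT // in_DesL !pcomp_refl_inv tpermL tpermR.
by apply: inv_total; rewrite -in_DesL (negbT di).
Qed.

Lemma b_fun_comm i j : i.+1 < j -> forall x,
  obind (b_fun i) (b_fun j x) = obind (b_fun j) (b_fun i x).
Proof.
move=> ij [g gI]; apply: omap_val_inj.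
rewrite (omap_val_obind (b_funE i)) (omap_val_obind (b_funE j)) !b_funE.
apply: (interval_act_comm convex) => //=.
- by move=> h; apply: weak_le_up.
- by move=> h; apply: weak_le_up.
- by move=> h; rewrite !in_DesL !pcomp_refl_inv !simple_refl_id // -val_eqE /=; lia.
- by move=> h; rewrite !in_DesL !pcomp_refl_inv !simple_refl_id // -val_eqE /=; lia.
- exact: simple_refl_comm.
Qed.

Lemma b_fun_braid i j : j = i.+1 :> nat -> forall x,
  obind (b_fun i) (obind (b_fun j) (b_fun i x)) =
  obind (b_fun j) (obind (b_fun i) (b_fun j x)).
Proof.
move=> ij [g gI]; apply: omap_val_inj.
rewrite !(omap_val_obind (b_funE i), omap_val_obind (b_funE j)) !b_funE.
have hl : hi i = lo j by apply: val_inj; rewrite /= ij.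
have nlo : lo i != lo j by rewrite -val_eqE /=; lia.
have nhi : lo i != hi j by rewrite -val_eqE /=; lia.
have nj := lo_neq_hi j.
apply: (interval_act_braid weak_le_tr convex _ _
  (a := fun h => (h^-1 (lo i))%g) (b := fun h => (h^-1 (lo j))%g)
  (c := fun h => (h^-1 (hi j))%g)) => //=.
- by move=> h; apply: weak_le_up.
- by move=> h; apply: weak_le_up.
- by move=> h; rewrite in_DesL hl.
- by move=> h; rewrite in_DesL.
- move=> h; rewrite !pcomp_refl_inv tpermL -hl tpermR simple_refl_id //.
    by rewrite eq_sym.
  by rewrite hl eq_sym.
- by move=> h; rewrite !pcomp_refl_inv tpermL tpermR simple_refl_id.
- exact: simple_refl_braid.
- by rewrite !(inj_eq val_inj) !(inj_eq (@perm_inj _ _)) nlo nhi nj.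
Qed.

Definition b_action : hecke_action n {g | g \in I} :=
  HeckeAction b_fun_idem b_fun_braid b_fun_comm.

End BAction.
End Permutations.

Section SortingAction.
Variables (T X : Type) (cmp : X -> X -> option bool).

Definition sorting_act (p q : T -> X) (u : T -> T) (t : T) : option T :=
  omap (fun b : bool => if b then u t else t) (cmp (p t) (q t)).

Lemma sorting_act_idem (p q : T -> X) (u : T -> T) t :
  (forall x y, cmp x y = Some true -> cmp y x = Some false) ->
  p (u t) = q t -> q (u t) = p t ->
  obind (sorting_act p q u) (sorting_act p q u t) = sorting_act p q u t.
Proof.
move=> cs pu qu; rewrite /sorting_act.
case e: (cmp (p t) (q t)) => [[]|] //=; last by rewrite e.
by rewrite pu qu (cs _ _ e).
Qed.

Lemma sorting_act_comm (p q p' q' : T -> X) (u v : T -> T) t :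
  p (v t) = p t -> q (v t) = q t -> p' (u t) = p' t -> q' (u t) = q' t ->
  u (v t) = v (u t) ->
  obind (sorting_act p q u) (sorting_act p' q' v t) =
  obind (sorting_act p' q' v) (sorting_act p q u t).
Proof.
move=> pv qv pu qu uv; rewrite /sorting_act.
case e: (cmp (p t) (q t)) => [[]|]; case e': (cmp (p' t) (q' t)) => [[]|];
  by rewrite /= ?pv ?qv ?pu ?qu ?e ?e' /= ?uv.
Qed.

End SortingAction.

Section SortingBraid.
Variables (T X : Type) (a b c : T -> X) (u v : T -> T).
Hypothesis ue : forall t, [/\ a (u t) = b t, b (u t) = a t & c (u t) = c t].
Hypothesis ve : forall t, [/\ a (v t) = a t, b (v t) = c t & c (v t) = b t].
Hypothesis uv_braid : forall t, u (v (u t)) = v (u (v t)).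
Variable k : X -> nat.

Variables (cmp : X -> X -> option bool) (tie : option bool) (s : X -> bool).
Hypothesis tieE : tie != Some true.
Hypothesis cmpE : forall x y, cmp x y = if k y < k x then Some false
  else if k x == k y then tie else if s x && s y then None else Some true.

Lemma sorting_act_braid t :
  obind (sorting_act cmp a b u)
    (obind (sorting_act cmp b c v) (sorting_act cmp a b u t)) =
  obind (sorting_act cmp b c v)
    (obind (sorting_act cmp a b u) (sorting_act cmp b c v t)).
Proof.
have au y : a (u y) = b y by case: (ue y).
have bu y : b (u y) = a y by case: (ue y).
have cu y : c (u y) = c y by case: (ue y).
have av y : a (v y) = a y by case: (ve y).
have bv y : b (v y) = c y by case: (ve y).
have cv y : c (v y) = b y by case: (ve y).
pose F := (au, bu, cu, av, bv, cv).
pose C := (cmpE (a t) (b t), cmpE (b t) (a t), cmpE (a t) (c t),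
  cmpE (c t) (a t), cmpE (b t) (c t), cmpE (c t) (b t)).
rewrite /sorting_act; move: C; rewrite [k (b t) == k (a t)]eq_sym.
rewrite [k (c t) == k (a t)]eq_sym [k (c t) == k (b t)]eq_sym.
case: (ltngtP (k (a t)) (k (b t))) => ab;
  case: (ltngtP (k (b t)) (k (c t))) => bc;
  case: (ltngtP (k (a t)) (k (c t))) => ac; try (by exfalso; lia).
all: case: tie tieE => [[]|] // _; case: (s (a t)); case: (s (b t));
  case: (s (c t)) => /= C.
all: by do 6?rewrite /= ?F ?C; rewrite /= ?uv_braid.
Qed.

End SortingBraid.

Record composition (n : nat) := Composition {
  parts :> seq nat;
  parts_gt0 : all (ltn 0) parts;
  sumn_parts : sumn parts = n }.

Section Tableaux.
Variables (n : nat) (alpha : composition n).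

(* Boxes of the composition diagram; rows (from the top) and columns (from the
   left) are zero-based. *)
Definition box : finType := {r : 'I_(size alpha) & 'I_(nth 0 alpha r)}.
Definition row (b : box) : nat := tag b.
Definition col (b : box) : nat := tagged b.

Lemma card_box : #|box| = n.
Proof.
rewrite card_tagged -[RHS](sumn_parts alpha); congr sumn.
apply: (@eq_from_nth _ 0); first by rewrite size_map size_enum_ord.
move=> i; rewrite size_map size_enum_ord => lti.
by rewrite (nth_map (Ordinal lti)) ?size_enum_ord // card_ord nth_enum_ord.
Qed.

Lemma box_inj (b b' : box) : row b = row b' -> col b = col b' -> b = b'.
Proof.
case: b => r c; case: b' => r' c'; rewrite /row /col /= => /val_inj rr.
by case: r' / rr c' => c' /val_inj->.
Qed.

Lemma col_lt (b : box) : col b < n.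
Proof.
case: b => r c; apply: (leq_trans (ltn_ord c)).
rewrite /= -[X in _ <= X](sumn_parts alpha) sumnE (big_nth 0) big_mkord.
by rewrite (bigD1 r) //= leq_addr.
Qed.

(* Entries are zero-based as well: i : 'I_n stands for the entry i + 1. *)
Definition filling := {T : {ffun box -> 'I_n} | injectiveb T}.

Definition entry (T : filling) (b : box) : 'I_n := val T b.

Lemma entry_inj T : injective (entry T).
Proof. exact/injectiveP/(valP T). Qed.

Lemma entry_onto T i : i \in codom (entry T).
Proof.
by apply: inj_card_onto; [exact: entry_inj | rewrite card_ord card_box].
Qed.

Definition pos (T : filling) (i : 'I_n) : box := iinv (entry_onto T i).

Lemma entryK T : cancel (entry T) (pos T).
Proof. by move=> b; apply: (@entry_inj T); rewrite /pos f_iinv. Qed.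

Lemma posK T : cancel (pos T) (entry T).
Proof. by move=> i; apply: f_iinv. Qed.

Lemma filling_eq (T T' : filling) : entry T =1 entry T' -> T = T'.
Proof. by move=> TT; apply/val_inj/ffunP. Qed.

Lemma make_filling_subproof (f : box -> 'I_n) :
  injective f -> injectiveb [ffun b => f b].
Proof. by move=> f_inj; apply/injectiveP => x y; rewrite !ffunE => /f_inj. Qed.

Definition make_filling (f : box -> 'I_n) (f_inj : injective f) : filling :=
  exist _ [ffun b => f b] (make_filling_subproof f_inj).

Lemma entry_make_filling f (f_inj : injective f) : entry (make_filling f_inj) =1 f.
Proof. by move=> b; rewrite /entry ffunE. Qed.

Lemma swap_inj (i : 'I_n.-1) (T : filling) :
  injective (fun b => simple_refl i (entry T b)).
Proof. by move=> b b' /perm_inj/entry_inj. Qed.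

Definition swap (i : 'I_n.-1) (T : filling) : filling :=
  make_filling (@swap_inj i T).

Lemma entry_swap i T b : entry (swap i T) b = simple_refl i (entry T b).
Proof. exact: entry_make_filling. Qed.

Lemma pos_swap i T x : pos (swap i T) x = pos T (simple_refl i x).
Proof.
apply: (@entry_inj (swap i T)).
by rewrite posK entry_swap posK -permM tperm2 perm1.
Qed.

Definition rows_increasing (T : filling) : bool :=
  [forall b : box, forall b' : box,
     (row b == row b') && (col b < col b') ==> (entry T b < entry T b')].

Definition columns_increasing (T : filling) : bool :=
  [forall b : box, forall b' : box,
     (col b == col b') && (row b < row b') ==> (entry T b < entry T b')].

Definition first_column_increasing (T : filling) : bool :=
  [forall b : box, forall b' : box,
     [&& col b == 0, col b' == 0 & row b < row b'] ==> (entry T b < entry T b')].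

Definition SIT_pred (T : filling) := rows_increasing T && first_column_increasing T.
Definition SET_pred (T : filling) := rows_increasing T && columns_increasing T.
Definition SIT := {T : filling | SIT_pred T}.
Definition SET := {T : filling | SET_pred T}.

(* Rows are numbered from the top, so row q <= row p says that p is weakly
   below q. In the last case, swapping i and i + 1 always yields an element of SIT
   (lemma SIT_swap below), so that insub never returns None. *)
Definition sit_fun (i : 'I_n.-1) (T : SIT) : option SIT :=
  let p := pos (val T) (lo i) in
  let q := pos (val T) (hi i) in
  if row q <= row p then Some T
  else if (col p == 0) && (col q == 0) then None
  else insub (swap i (val T)).

(* Here too, insub never returns None (lemma SET_swap below). *)
Definition set_fun (i : 'I_n.-1) (T : SET) : option SET :=
  let p := pos (val T) (lo i) in
  let q := pos (val T) (hi i) in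
  if col p < col q then Some T
  else if col p == col q then None
  else insub (swap i (val T)).

Lemma simple_refl_lt i (x y : 'I_n) :
  x < y -> (x, y) != (lo i, hi i) -> simple_refl i x < simple_refl i y.
Proof.
move=> xy; rewrite xpair_eqE /simple_refl !permE /= -!val_eqE /=.
by do ![case: ifP => /=]; lia.
Qed.

Lemma swap_lt i T b b' : entry T b < entry T b' ->
  (b, b') != (pos T (lo i), pos T (hi i)) ->
  entry (swap i T) b < entry (swap i T) b'.
Proof.
move=> lt ne; rewrite !entry_swap; apply: simple_refl_lt => //.
by apply: contraNneq ne => -[<- <-]; rewrite !entryK.
Qed.

Lemma swap_forall2 i T (r : rel box) :
  ~~ r (pos T (lo i)) (pos T (hi i)) ->
  [forall b : box, forall b' : box, r b b' ==> (entry T b < entry T b')] ->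
  [forall b : box, forall b' : box,
     r b b' ==> (entry (swap i T) b < entry (swap i T) b')].
Proof.
move=> nr /forallP rT; apply/forallP => b; apply/forallP => b'; apply/implyP => rb.
apply: swap_lt; first by have /forallP/(_ b')/implyP/(_ rb) := rT b.
by apply: contraNneq nr => -[<- <-].
Qed.

Lemma SIT_swap i (T : filling) : SIT_pred T ->
  row (pos T (lo i)) < row (pos T (hi i)) ->
  ~~ ((col (pos T (lo i)) == 0) && (col (pos T (hi i)) == 0)) ->
  SIT_pred (swap i T).
Proof.
move=> /andP[Tr Tc] rlt cn; apply/andP; split; apply: swap_forall2 => //.
  by rewrite negb_and neq_ltn rlt.
by rewrite /= andbA negb_and cn.
Qed.

Lemma SET_swap i (T : filling) : SET_pred T ->
  col (pos T (hi i)) < col (pos T (lo i)) -> SET_pred (swap i T).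
Proof.
move=> /andP[Tr Tc] clt; apply/andP; split; apply: swap_forall2 => //.
  by rewrite negb_and -leqNgt (ltnW clt) orbT.
by rewrite negb_and neq_ltn clt orbT.
Qed.

Definition sit_cmp (p q : box) : option bool :=
  if row q <= row p then Some false
  else if (col p == 0) && (col q == 0) then None else Some true.

Definition set_cmp (p q : box) : option bool :=
  if col p < col q then Some false
  else if col p == col q then None else Some true.

Lemma sit_funE i T : omap val (sit_fun i T) =
  sorting_act sit_cmp (pos^~ (lo i)) (pos^~ (hi i)) (swap i) (val T).
Proof.
rewrite /sit_fun /sorting_act /sit_cmp; case: leqP => // rlt.
case: ifP => // cn; rewrite insubT //=.
by apply: SIT_swap; rewrite ?rlt ?cn //; apply: (valP T).
Qed.

Lemma set_funE i T : omap val (set_fun i T) =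
  sorting_act set_cmp (pos^~ (lo i)) (pos^~ (hi i)) (swap i) (val T).
Proof.
rewrite /set_fun /sorting_act /set_cmp; case: ltngtP => //= clt.
by rewrite insubT //=; apply: SET_swap; rewrite ?clt //; apply: (valP T).
Qed.

Lemma swap_comm (i j : 'I_n.-1) T : i.+1 < j -> swap i (swap j T) = swap j (swap i T).
Proof.
move=> ij; apply: filling_eq => b; rewrite !entry_swap.
have := congr1 (fun s : 'S_n => s (entry T b)) (simple_refl_comm 1%g ij).
by rewrite !pcompE perm1.
Qed.

Lemma swap_braid (i j : 'I_n.-1) T : j = i.+1 :> nat ->
  swap i (swap j (swap i T)) = swap j (swap i (swap j T)).
Proof.
move=> ij; apply: filling_eq => b; rewrite !entry_swap.
have := congr1 (fun s : 'S_n => s (entry T b)) (simple_refl_braid 1%g ij).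
by rewrite !pcompE perm1.
Qed.

Section Relations.
Variables (P : pred filling) (f : 'I_n.-1 -> {T | P T} -> option {T | P T}).
Variable cmp : box -> box -> option bool.
Hypothesis fE : forall i T, omap val (f i T) =
  sorting_act cmp (pos^~ (lo i)) (pos^~ (hi i)) (swap i) (val T).
Variables (k : box -> nat) (tie : option bool) (s : box -> bool).
Hypothesis tieE : tie != Some true.
Hypothesis cmpE : forall x y, cmp x y = if k y < k x then Some false
  else if k x == k y then tie else if s x && s y then None else Some true.

Lemma tableau_idem i T : obind (f i) (f i T) = f i T.
Proof.
apply: omap_val_inj; rewrite (omap_val_obind (fE i)) fE.
apply: sorting_act_idem; rewrite ?pos_swap ?tpermL ?tpermR //.
move=> x y; rewrite !cmpE; case: ltngtP => // _; last by move: tieE; case: tie => [[]|].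
Qed.

Lemma tableau_comm (i j : 'I_n.-1) : i.+1 < j -> forall T,
  obind (f i) (f j T) = obind (f j) (f i T).
Proof.
move=> ij T; apply: omap_val_inj.
rewrite (omap_val_obind (fE i)) (omap_val_obind (fE j)) !fE.
apply: sorting_act_comm; rewrite ?pos_swap; last exact: swap_comm.
all: by rewrite simple_refl_id // -val_eqE /=; lia.
Qed.

Lemma tableau_braid (i j : 'I_n.-1) : j = i.+1 :> nat -> forall T,
  obind (f i) (obind (f j) (f i T)) = obind (f j) (obind (f i) (f j T)).
Proof.
move=> ij T; apply: omap_val_inj.
rewrite !(omap_val_obind (fE i), omap_val_obind (fE j)) !fE.
have hl : hi i = lo j by apply: val_inj; rewrite /= ij.
rewrite hl; apply: (sorting_act_braid _ _ _ tieE cmpE) => {}T.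
- rewrite !pos_swap -hl tpermL tpermR simple_refl_id // -val_eqE /=; lia.
- rewrite !pos_swap tpermL tpermR simple_refl_id // -val_eqE /=; lia.
- exact: swap_braid.
Qed.

Definition tableau_action : hecke_action n {T | P T} :=
  HeckeAction tableau_idem tableau_braid tableau_comm.

End Relations.

Lemma sit_cmpE (x y : box) : sit_cmp x y = if row y < row x then Some false
  else if row x == row y then Some false
  else if (col x == 0) && (col y == 0) then None else Some true.
Proof. by rewrite /sit_cmp; case: ltngtP. Qed.

Lemma set_cmpE (x y : box) :
  set_cmp x y = if n - col y < n - col x then Some false
  else if n - col x == n - col y then None
  else if false && false then None else Some true.
Proof.
have xn := col_lt x; have yn := col_lt y; rewrite /set_cmp.
by case: ltngtP => ?; case: ltngtP => ? //; exfalso; lia.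
Qed.

Definition sit_action : hecke_action n SIT :=
  @tableau_action SIT_pred sit_fun sit_cmp sit_funE row (Some false)
    (fun b => col b == 0) isT sit_cmpE.

Definition set_action : hecke_action n SET :=
  @tableau_action SET_pred set_fun set_cmp set_funE (fun b => n - col b) None
    (fun=> false) isT set_cmpE.

Lemma sit_actionE i T : sit_action i T = sit_fun i T. Proof. by []. Qed.
Lemma set_actionE i T : set_action i T = set_fun i T. Proof. by []. Qed.

End Tableaux.

Lemma uniq_flatten_map (S X : eqType) (key : X -> S) (F : S -> seq X) (s : seq S) :
  uniq s -> (forall y, uniq (F y)) -> (forall y x, x \in F y -> key x = y) ->
  uniq (flatten [seq F y | y <- s]).
Proof.
move=> + uF kF; elim: s => //= y s IHs /andP[ys /IHs us].
rewrite cat_uniq uF us andbT; apply/hasPn => x /flatten_mapP[z zs xz].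
apply/negP => /= /kF; rewrite (kF _ _ xz) => zy; by rewrite -zy zs in ys.
Qed.

Section ReadingOrders.
Variables (n : nat) (alpha : composition n).
Local Notation box := (box alpha).

Definition row_boxes (r : 'I_(size alpha)) : seq box :=
  [seq Tagged (fun r : 'I_(size alpha) => 'I_(nth 0 alpha r)) c
     | c <- enum 'I_(nth 0 alpha r)].

Definition row_order : seq box :=
  flatten [seq row_boxes r | r <- enum 'I_(size alpha)].

(* The boxes of column c from top to bottom. *)
Definition column_boxes (c : nat) : seq box := [seq b <- row_order | col b == c].

Definition sit_sink_order : seq box :=
  column_boxes 0 ++
  flatten [seq [seq b <- row_boxes r | col b != 0] | r <- rev (enum 'I_(size alpha))].

Definition column_order : seq box :=
  flatten [seq column_boxes c | c <- iota 0 n].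

Definition read_order : seq box :=
  flatten [seq rev (row_boxes r) | r <- enum 'I_(size alpha)].

Lemma row_boxes_uniq r : uniq (row_boxes r).
Proof.
rewrite map_inj_uniq ?enum_uniq // => c c' /eqP.
by rewrite -tag_eqE /tag_eq /= eqxx tagged_asE => /eqP.
Qed.

Lemma mem_row_boxes r b : (b \in row_boxes r) = (tag b == r).
Proof.
apply/mapP/eqP => [[c _ ->]//|<-]; exists (tagged b); rewrite ?mem_enum //.
by case: b.
Qed.

Lemma row_order_uniq : uniq row_order.
Proof.
apply: (uniq_flatten_map (key := tag)) => [||r b]; first exact: enum_uniq.
  exact: row_boxes_uniq.
by rewrite mem_row_boxes => /eqP.
Qed.

Lemma mem_row_order b : b \in row_order.
Proof.
by apply/flatten_mapP; exists (tag b); rewrite ?mem_enum ?mem_row_boxes.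
Qed.

Lemma read_order_uniq : uniq read_order.
Proof.
apply: (uniq_flatten_map (key := tag)) => [|r|r b]; first exact: enum_uniq.
  by rewrite rev_uniq row_boxes_uniq.
by rewrite mem_rev mem_row_boxes => /eqP.
Qed.

Lemma mem_read_order b : b \in read_order.
Proof.
by apply/flatten_mapP; exists (tag b); rewrite ?mem_enum ?mem_rev ?mem_row_boxes.
Qed.

Lemma mem_column_boxes c b : (b \in column_boxes c) = (col b == c).
Proof. by rewrite mem_filter mem_row_order andbT. Qed.

Lemma column_order_uniq : uniq column_order.
Proof.
apply: (uniq_flatten_map (key := @col n alpha)) => [|c|c b]; first exact: iota_uniq.
  exact/filter_uniq/row_order_uniq.
by rewrite mem_column_boxes => /eqP.
Qed.

Lemma mem_column_order b : b \in column_order.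
Proof.
apply/flatten_mapP; exists (col b); rewrite ?mem_column_boxes //.
by rewrite mem_iota add0n col_lt.
Qed.

Lemma sit_sink_order_uniq : uniq sit_sink_order.
Proof.
rewrite cat_uniq filter_uniq ?row_order_uniq //=; apply/andP; split.
  apply/hasPn => b /flatten_mapP[r _]; rewrite mem_filter => /andP[cb _].
  by rewrite /= mem_column_boxes.
apply: (uniq_flatten_map (key := tag)) => [|r|r b].
- by rewrite rev_uniq enum_uniq.
- exact/filter_uniq/row_boxes_uniq.
- by rewrite mem_filter mem_row_boxes => /andP[_ /eqP].
Qed.

Lemma mem_sit_sink_order b : b \in sit_sink_order.
Proof.
rewrite mem_cat mem_column_boxes; case: eqP => //= /eqP cb.
apply/flatten_mapP; exists (tag b); first by rewrite mem_rev mem_enum.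
by rewrite mem_filter cb mem_row_boxes /=.
Qed.

Lemma size_listing (s : seq box) : uniq s -> (forall b, b \in s) -> size s = n.
Proof.
move=> us ms; rewrite -[RHS](card_box alpha) -(card_uniqP us).
by apply: eq_card => b; rewrite ms inE.
Qed.

Section FillAlong.
Variables (s : seq box) (us : uniq s) (ms : forall b, b \in s).

Lemma index_listing b : index b s < n.
Proof. by rewrite -[X in _ < X](size_listing us ms) index_mem. Qed.

Lemma fill_along_inj : injective (fun b => Ordinal (index_listing b)).
Proof. by move=> b b' [] /index_inj; apply. Qed.

(* The filling that puts 1, 2, ..., n in the successive boxes of the list s. *)
Definition fill_along : filling alpha := make_filling fill_along_inj.

End FillAlong.

Definition source := fill_along row_order_uniq mem_row_order.
Definition sit_sink := fill_along sit_sink_order_uniq mem_sit_sink_order.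
Definition set_sink := fill_along column_order_uniq mem_column_order.

Lemma size_read T : size [seq entry T b | b <- read_order] == n.
Proof.
by rewrite size_map (size_listing read_order_uniq mem_read_order).
Qed.

Definition read (T : filling alpha) : n.-tuple 'I_n := Tuple (size_read T).

Lemma read_uniq T : uniq (read T).
Proof. by rewrite /= map_inj_uniq ?read_order_uniq //; apply: entry_inj. Qed.

Lemma read_inj T : injective (tnth (read T)).
Proof. exact/tuple_uniqP/read_uniq. Qed.

(* The word read T viewed as a permutation in one-line notation. *)
Definition read_perm (T : filling alpha) : 'S_n := perm (@read_inj T).

End ReadingOrders.

Section Modules.
Variables (K : fieldType) (n : nat).

Definition B_mod (s t : 'S_n) : lmodType (hecke_alg K n) :=
  basis_mod K (b_action s t).

Definition V_mod (alpha : composition n) : lmodType (hecke_alg K n) :=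
  basis_mod K (sit_action alpha).

Definition X_mod (alpha : composition n) : lmodType (hecke_alg K n) :=
  basis_mod K (set_action alpha).

End Modules.

(* Main.v *)
Require Import Defs.
From HB Require Import structures.
From mathcomp Require Import all_boot all_order all_fingroup all_algebra.
From mathcomp Require Import complex reals zify.
(* Gives row, col and pcomp their meaning for diagrams and permutations again. *)
Import Defs.

Set Implicit Arguments.
Unset Strict Implicit.
Unset Printing Implicit Defensive.

Import GRing.Theory.
Local Open Scope ring_scope.
Local Open Scope complex_scope.

(** Reading identifies fillings of the diagram with permutations: if the boxes
are numbered in reading order, then [read_perm T] sends the number of a box to
its entry, and swapping [i] and [i + 1] in [T] multiplies [read_perm T] by [s_i]
on the left. The two isomorphisms are the linear extensions of this bijection,
so everything reduces to two combinatorial facts for each family of tableaux.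

The tableaux are exactly the fillings whose reading lies in the interval
([SIT_interval], [SET_interval]). The left weak order is inclusion of inversion
sets ([weak_le_inversions]), where an inversion of a reading is a pair of boxes,
the first one read earlier, whose entries decrease. The source inverts exactly
the pairs of boxes in the same row, so lying above the source means that rows
increase. Lying below a sink means that every pair of boxes in increasing order
in the sink, the first one in a higher row, is also in increasing order in the
tableau. For the sink of SIT the first box of such a pair is in the first column
and the second one is arbitrary; for the sink of SET the second box is weakly to
the right of the first. When rows increase, these conditions follow from the
cases where both boxes lie in the first column, respectively in the same column,
because the diagram is left-justified.

The actions correspond ([sit_action_descent], [set_action_descent]): on both
sides [pi_i] fixes the basis element when [i] is a left descent, that is, when
the box of [i + 1] is read before that of [i]; otherwise it applies [s_i], and
gives zero when the result leaves the family. On tableaux the descent condition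
has to be matched with the geometric conditions that define the actions, and the
zero case with the failure of the column condition after the swap. *)

(** * Isomorphisms of modules from bijections of bases *)

Section BasisIso.
Variables (K : fieldType) (n : nat) (T U : finType).
Variables (a : hecke_action n T) (b : hecke_action n U) (f : T -> U) (g : U -> T).
Hypotheses (fK : cancel f g) (gK : cancel g f).
Hypothesis fab : forall i t, b i (f t) = omap f (a i t).

(** The linear extension of [f], written on coordinate families. *)
Definition relabel (v : {ffun T -> K^o}) : {ffun U -> K^o} := [ffun u => v (g u)].

Lemma relabel_bgen i v : relabel (bgen a i v) = bgen b i (relabel v).
Proof.
apply/ffunP => u; rewrite ffunE /bgen !sum_ffunE.
rewrite [RHS](reindex f) /=; last by exists g => x _; rewrite ?fK ?gK.
apply: eq_bigr => t _; rewrite !ffunE fK fab; congr (_ *: _).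
by case: (a i t) => [w|] /=; rewrite !ffunE // (can2_eq gK fK).
Qed.

Lemma relabel_heval t v : relabel (heval (bgen a) t v) = heval (bgen b) t (relabel v).
Proof.
elim: t v => [c|i|x IHx y IHy|x IHx y IHy] v /=; last by rewrite IHx IHy.
- by apply/ffunP => u; rewrite !ffunE.
- exact: relabel_bgen.
- by rewrite -IHx -IHy; apply/ffunP => u; rewrite !ffunE.
Qed.

(** Every element of the Hecke algebra is the class of a term in the generators,
so commuting with the generators is enough for linearity over the algebra. *)
Lemma basis_bijection_iso : hecke_iso (basis_mod K a) (basis_mod K b).
Proof.
have lin : linear (relabel : basis_mod K a -> basis_mod K b).
  move=> x u v; rewrite -[x]hclass_repr.
  rewrite [_ *: u]bscale_hclass [_ *: (relabel u : basis_mod K b)]bscale_hclass.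
  by rewrite -relabel_heval; apply/ffunP => w; rewrite !ffunE.
pose L := GRing.isLinear.Build (hecke_alg K n) (basis_mod K a) (basis_mod K b) _ _ lin.
pose F : {linear basis_mod K a -> basis_mod K b} :=
  HB.pack (relabel : basis_mod K a -> basis_mod K b) L.
exists F.
exists (fun v : basis_mod K b => [ffun t => v (f t)] : basis_mod K a) => v /=.
  by apply/ffunP => t; rewrite !ffunE fK.
by apply/ffunP => u; rewrite !ffunE gK.
Qed.

End BasisIso.

Local Open Scope nat_scope.

(** * The left weak order as inclusion of inversion sets *)

Section WeakOrder.
Variable n : nat.
Implicit Types s t g : 'S_n.

(** The inversions of [g], taken as pairs of positions in either order. In this
symmetric form the inversions of a product are a symmetric difference
([flips_pcomp]), without any sorting of the pairs transported by [s]. *)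
Definition flips g : {set 'I_n * 'I_n} :=
  [set p : 'I_n * 'I_n | (p.1 < p.2) != (g p.1 < g p.2)].

Lemma card_flips g : #|flips g| = (#|inversions g|).*2.
Proof.
have swapI : injective (fun p : 'I_n * 'I_n => (p.2, p.1)) by move=> [? ?] [? ?] [-> ->].
rewrite -addnn -{2}(card_preimset (inversions g) swapI) -cardsUI.
rewrite (_ : _ :&: _ = set0) ?cards0 ?addn0; last first.
  by apply/setP => -[x y]; rewrite !inE /=; lia.
congr #|pred_of_set _|; apply/setP => -[x y]; rewrite !inE /=.
have : (x == y) = (g x == g y) by rewrite (inj_eq perm_inj).
by rewrite -!val_eqE /=; lia.
Qed.

Lemma flips_pcomp g s :
  flips (pcomp g s) = (flips s :\: [set p | (s p.1, s p.2) \in flips g])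
   :|: ([set p | (s p.1, s p.2) \in flips g] :\: flips s).
Proof. by apply/setP => -[x y]; rewrite !inE /= !pcompE; lia. Qed.

Lemma card_flips_pull g s : #|[set p | (s p.1, s p.2) \in flips g]| = #|flips g|.
Proof.
have sI : injective (fun p : 'I_n * 'I_n => (s p.1, s p.2)).
  by move=> [? ?] [? ?] [/perm_inj-> /perm_inj->].
by rewrite -(card_preimset (flips g) sI); apply: eq_card => p; rewrite !inE.
Qed.

(** The length of a product [g s] is the sum of the lengths exactly when the
symmetric difference in [flips_pcomp] is a disjoint union, that is, when no
inversion of [s] is undone by [g]. *)
Lemma weak_le_inversions s t : weak_le s t = (inversions s \subset inversions t).
Proof.
have lenE g : (coxeter_length (pcomp g s) == coxeter_length g + coxeter_length s) =
    [disjoint flips s & [set p | (s p.1, s p.2) \in flips g]].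
  set D := [set p | _]; have cD : #|D| = #|flips g| := card_flips_pull g s.
  have := cardsID D (flips s); have := cardsID (flips s) D.
  rewrite -setI_eq0 -cards_eq0 (setIC D).
  have := cardsUI (flips s :\: D) (D :\: flips s).
  have -> : (flips s :\: D) :&: (D :\: flips s) = set0.
    apply/setP => p; rewrite !in_setI !in_setD in_set0.
    by case: (p \in flips s); case: (p \in D).
  have arith L A B I G S : L.*2 + 0 = A + B -> I + B = G.*2 -> I + A = S.*2 ->
    (L == G + S) = (I == 0) by lia.
  rewrite -flips_pcomp cards0 cD !card_flips !coxeter_lengthE; exact: arith.
apply/existsP/idP => [[g /andP[/eqP-> ]]|st].
  rewrite lenE => /pred0P dis; apply/subsetP => -[x y].
  have : (x == y) = (g (s x) == g (s y)) by rewrite !(inj_eq perm_inj).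
  by have := dis (x, y); rewrite -!val_eqE !inE /= !pcompE; lia.
exists (s^-1 * t)%g; have tE : pcomp (s^-1 * t)%g s = t by rewrite /pcomp mulKVg.
rewrite tE eqxx /= -{1}tE lenE; apply/pred0P => -[x y].
rewrite !inE /= -!pcompE tE; move/subsetP: st => st.
have := st (x, y); have := st (y, x); rewrite !inE /=.
have : (x == y) = (s x == s y) by rewrite (inj_eq perm_inj).
have : (x == y) = (t x == t y) by rewrite (inj_eq perm_inj).
by rewrite -!val_eqE /=; lia.
Qed.

End WeakOrder.

(** * Lists that enumerate a relation *)

Lemma pairwise_flatten_map (S : Type) (X : eqType) (r : rel X) (q : rel S)
    (F : S -> seq X) (s : seq S) :
  pairwise q s -> (forall y, pairwise r (F y)) ->
  (forall y z, q y z -> {in F y & F z, forall x x', r x x'}) ->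
  pairwise r (flatten [seq F y | y <- s]).
Proof.
move=> qs rF qr; elim: s qs => //= y s IHs /andP[qys /IHs rs].
rewrite pairwise_cat rF rs !andbT.
elim: s qys {IHs rs} => [|z s IHs] /=; first by rewrite allrel0r.
by case/andP => qyz /IHs rs; rewrite allrel_catr rs andbT; apply/allrelP/qr.
Qed.

Lemma pairwise_rev (X : Type) (r : rel X) (s : seq X) :
  pairwise r (rev s) = pairwise (fun x y => r y x) s.
Proof.
elim: s => //= x s IHs; rewrite rev_cons -cats1 pairwise_cat IHs allrel1r all_rev /=.
by rewrite andbT.
Qed.

Lemma pairwise_enum_ord m : pairwise (fun i j : 'I_m => i < j) (enum 'I_m).
Proof.
rewrite -(pairwise_map val ltn) val_enum_ord -sorted_pairwise ?iota_ltn_sorted //.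
exact: ltn_trans.
Qed.

(** Any two places of the list compare, so an asymmetric relation that holds
from left to right cannot hold anywhere else. *)
Lemma ltn_index_pairwise (X : eqType) (r : rel X) (s : seq X) :
  (forall x y, r x y -> ~~ r y x) -> pairwise r s ->
  {in s &, forall x y, (index x s < index y s) = r x y}.
Proof.
move=> asym rs x y xs ys.
have imp u v : u \in s -> v \in s -> index u s < index v s -> r u v.
  move=> us vs uv; have /(pairwiseP u) := rs.
  by move=> /(_ (index u s) (index v s)); rewrite !inE !index_mem !nth_index //; apply.
apply/idP/idP => [|rxy]; first exact: imp.
case: ltngtP => // [yx|/index_inj exy].
  by have := asym _ _ (imp _ _ ys xs yx); rewrite rxy.
by move: rxy (asym _ _ rxy); rewrite -(exy x xs ys) => ->.
Qed.

(** * Geometry of the reading and of the sources and sinks *)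

Section Listings.
Variables (n : nat) (alpha : composition n).
Local Notation box := (box alpha).
Implicit Types (b c : box) (S T : filling alpha).

Definition row_lt b c := (row b < row c) || (row b == row c) && (col b < col c).
Definition read_lt b c := (row b < row c) || (row b == row c) && (col c < col b).
Definition column_lt b c := (col b < col c) || (col b == col c) && (row b < row c).
Definition sit_sink_lt b c :=
  if col b == 0 then (col c != 0) || (row b < row c)
  else (col c != 0) && ((row c < row b) || (row b == row c) && (col b < col c)).

Lemma pairwise_row_boxes r :
  pairwise (fun b c => col b < col c) (row_boxes (alpha := alpha) r).
Proof. by rewrite pairwise_map pairwise_enum_ord. Qed.

Lemma pairwise_row_boxes_row r (P : rel box) :
  (forall b c, row b = row c -> col b < col c -> P b c) -> pairwise P (row_boxes r).
Proof.
move=> colP.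
apply: (sub_in_pairwise (P := [in row_boxes r]) (r := fun b c => col b < col c)).
- move=> b c; rewrite !mem_row_boxes => /eqP rb /eqP rc; apply: colP.
  by rewrite /row rb rc.
- exact/allP.
- exact: pairwise_row_boxes.
Qed.

Lemma pairwise_row_order : pairwise row_lt (row_order alpha).
Proof.
apply: (pairwise_flatten_map (pairwise_enum_ord _)).
- move=> r; apply: pairwise_row_boxes_row => b c.
  by rewrite /row_lt => -> ->; rewrite eqxx orbT.
- move=> r r' rr b c; rewrite !mem_row_boxes /row_lt /row => /eqP-> /eqP->.
  by rewrite rr.
Qed.

Lemma pairwise_read_order : pairwise read_lt (read_order alpha).
Proof.
apply: (pairwise_flatten_map (pairwise_enum_ord _)).
- move=> r; rewrite pairwise_rev; apply: pairwise_row_boxes_row => b c.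
  by rewrite /read_lt => -> ->; rewrite eqxx orbT.
- move=> r r' rr b c; rewrite !mem_rev !mem_row_boxes /read_lt /row => /eqP-> /eqP->.
  by rewrite rr.
Qed.

Lemma pairwise_column_boxes k (P : rel box) :
  (forall b c, col b = k -> col c = k -> row b < row c -> P b c) ->
  pairwise P (column_boxes alpha k).
Proof.
move=> rowP; apply: (sub_in_pairwise (P := [in column_boxes alpha k]) (r := row_lt)).
- move=> b c; rewrite !mem_column_boxes => /eqP cb /eqP cc.
  by rewrite /row_lt cb cc ltnn andbF orbF; apply: rowP.
- exact/allP.
- exact/pairwise_filter/pairwise_row_order.
Qed.

Lemma pairwise_column_order : pairwise column_lt (column_order alpha).
Proof.
apply: (pairwise_flatten_map (q := ltn)).
- by rewrite -sorted_pairwise ?iota_ltn_sorted //; apply: ltn_trans.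
- move=> k; apply: pairwise_column_boxes => b c.
  by rewrite /column_lt => -> -> ->; rewrite eqxx orbT.
- move=> k l /= kl b c; rewrite !mem_column_boxes /column_lt => /eqP-> /eqP->.
  by rewrite kl.
Qed.

Lemma pairwise_sit_sink_order : pairwise sit_sink_lt (sit_sink_order alpha).
Proof.
rewrite pairwise_cat; apply/and3P; split.
- apply/allrelP => b c; rewrite mem_column_boxes => cb /flatten_mapP[r _].
  by rewrite mem_filter => /andP[cc _]; rewrite /sit_sink_lt cb cc.
- by apply: pairwise_column_boxes => b c; rewrite /sit_sink_lt => -> _ ->; rewrite orbT.
apply: (pairwise_flatten_map (q := fun r r' : 'I_(size alpha) => r' < r)).
- by rewrite pairwise_rev pairwise_enum_ord.
- move=> r.
  apply: (sub_in_pairwise (P := [in [seq b <- row_boxes r | col b != 0]])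
    (r := fun b c => col b < col c)).
  + move=> b c; rewrite !mem_filter !mem_row_boxes.
    move=> /andP[/negPf cb /eqP rb] /andP[cc /eqP rc].
    by rewrite /sit_sink_lt cb cc /row rb rc eqxx => ->; rewrite orbT.
  + exact/allP.
  + exact/pairwise_filter/pairwise_row_boxes.
- move=> r r' rr b c; rewrite !mem_filter !mem_row_boxes.
  move=> /andP[/negPf cb /eqP rb] /andP[cc /eqP rc].
  by rewrite /sit_sink_lt cb cc /row rb rc rr.
Qed.

Lemma ltn_entry_fill_along s (us : uniq s) (ms : forall b, b \in s) (r : rel box) :
  pairwise r s -> (forall b c, r b c -> ~~ r c b) ->
  forall b c, (entry (fill_along us ms) b < entry (fill_along us ms) c) = r b c.
Proof.
move=> rs asym b c; rewrite !entry_make_filling /=.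
by rewrite (ltn_index_pairwise asym rs) ?ms.
Qed.

Lemma ltn_entry_source b c :
  (entry (source alpha) b < entry (source alpha) c) = row_lt b c.
Proof.
apply: (ltn_entry_fill_along _ _ pairwise_row_order) => {}b {}c.
by rewrite /row_lt; lia.
Qed.

Lemma ltn_entry_sit_sink b c :
  (entry (sit_sink alpha) b < entry (sit_sink alpha) c) = sit_sink_lt b c.
Proof.
apply: (ltn_entry_fill_along _ _ pairwise_sit_sink_order) => {}b {}c.
by rewrite /sit_sink_lt; do !case: eqP; lia.
Qed.

Lemma ltn_entry_set_sink b c :
  (entry (set_sink alpha) b < entry (set_sink alpha) c) = column_lt b c.
Proof.
apply: (ltn_entry_fill_along _ _ pairwise_column_order) => {}b {}c.
by rewrite /column_lt; lia.
Qed.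

(** * Reading as a bijection between fillings and permutations *)

Definition reading_index b : 'I_n :=
  Ordinal (index_listing (@read_order_uniq n alpha) (@mem_read_order n alpha) b).

Lemma ltn_reading_index b c : (reading_index b < reading_index c) = read_lt b c.
Proof.
rewrite /= (ltn_index_pairwise _ pairwise_read_order) ?mem_read_order //.
by move=> {}b {}c; rewrite /read_lt; lia.
Qed.

Lemma reading_index_inj : injective reading_index.
Proof. by move=> b c [] /index_inj; apply; rewrite ?mem_read_order. Qed.

Lemma reading_index_onto x : exists b, reading_index b = x.
Proof.
have [g _ gK] : bijective reading_index.
  by apply: inj_card_bij reading_index_inj _; rewrite card_ord card_box.
by exists (g x).
Qed.

Lemma read_permE T b : read_perm T (reading_index b) = entry T b.
Proof.
rewrite permE (tnth_nth (entry T b)) /= (nth_map b) ?nth_index ?index_mem //.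
all: exact: mem_read_order.
Qed.

Lemma read_permV T b : ((read_perm T)^-1)%g (entry T b) = reading_index b.
Proof. by rewrite -read_permE permK. Qed.

Lemma read_perm_swap i T : read_perm (swap i T) = pcomp (simple_refl i) (read_perm T).
Proof.
apply/permP => x; have [b <-] := reading_index_onto x.
by rewrite pcompE !read_permE entry_swap.
Qed.

Lemma unread_inj (g : 'S_n) : injective (fun b => g (reading_index b)).
Proof. by move=> b c /perm_inj /reading_index_inj. Qed.

Definition unread (g : 'S_n) : filling alpha := make_filling (@unread_inj g).

Lemma unreadK : cancel unread (@read_perm n alpha).
Proof.
move=> g; apply/permP => x; have [b <-] := reading_index_onto x.
by rewrite read_permE entry_make_filling.
Qed.

Lemma read_permK : cancel (@read_perm n alpha) unread.
Proof. by move=> T; apply: filling_eq => b; rewrite entry_make_filling read_permE. Qed.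

Lemma in_DesL_read i T :
  (i \in DesL (read_perm T)) = read_lt (pos T (hi i)) (pos T (lo i)).
Proof.
rewrite in_DesL -{1}(posK T (hi i)) -{1}(posK T (lo i)).
by rewrite !read_permV ltn_reading_index.
Qed.

Lemma weak_le_readP S T :
  reflect (forall b c, read_lt b c -> entry S c < entry S b -> entry T c < entry T b)
          (weak_le (read_perm S) (read_perm T)).
Proof.
rewrite weak_le_inversions; apply: (iffP subsetP) => [sub b c bc Sbc|sub [x y]].
  have := sub (reading_index b, reading_index c).
  by rewrite !inE ltn_reading_index !read_permE bc Sbc; apply.
have [b <-] := reading_index_onto x; have [c <-] := reading_index_onto y.
rewrite !inE ltn_reading_index !read_permE /= => /andP[bc Sbc].
by rewrite bc sub.
Qed.

(** * Standard tableaux as intervals of the weak order *)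

Lemma rows_increasingP T :
  reflect (forall b c, row b = row c -> col b < col c -> entry T b < entry T c)
          (rows_increasing T).
Proof.
apply: (iffP 'forall_forallP) => [inc b c rr cc|inc b c].
  by have := implyP (inc b c); rewrite rr eqxx cc; apply.
by apply/implyP => /andP[/eqP rr cc]; apply: inc.
Qed.

Lemma columns_increasingP T :
  reflect (forall b c, col b = col c -> row b < row c -> entry T b < entry T c)
          (columns_increasing T).
Proof.
apply: (iffP 'forall_forallP) => [inc b c cc rr|inc b c].
  by have := implyP (inc b c); rewrite rr cc eqxx; apply.
by apply/implyP => /andP[/eqP cc rr]; apply: inc.
Qed.

Lemma first_column_increasingP T :
  reflect (forall b c, col b = 0 -> col c = 0 -> row b < row c -> entry T b < entry T c)
          (first_column_increasing T).
Proof.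
apply: (iffP 'forall_forallP) => [inc b c cb cc rr|inc b c].
  by have := implyP (inc b c); rewrite rr cb cc eqxx; apply.
by apply/implyP => /and3P[/eqP cb /eqP cc rr]; apply: inc.
Qed.

(** Rows are read from right to left and the source increases along them, so the
inversions of the source are the pairs of boxes of the same row. *)
Lemma weak_le_source T :
  weak_le (read_perm (source alpha)) (read_perm T) = rows_increasing T.
Proof.
apply/weak_le_readP/rows_increasingP => inc b c.
  move=> rr cc; apply: inc; first by rewrite /read_lt rr eqxx cc orbT.
  by rewrite ltn_entry_source /row_lt rr eqxx cc orbT.
by rewrite /read_lt ltn_entry_source /row_lt => rl sl; apply: inc; lia.
Qed.

(** The contrapositive of inclusion of inversions. A pair of boxes in the same
row is an inversion of both readings when both fillings have increasing rows, so
only pairs in different rows matter. *)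
Lemma weak_le_sinkP T sink (r : rel box) : rows_increasing T ->
  (forall b c, (entry sink b < entry sink c) = r b c) ->
  (forall b c, row b = row c -> col b < col c -> r b c) ->
  reflect (forall b c, row b < row c -> r b c -> entry T b < entry T c)
          (weak_le (read_perm T) (read_perm sink)).
Proof.
move=> /rows_increasingP Tr sr rr; apply: (iffP (weak_le_readP _ _)) => inc b c.
  move=> rbc; rewrite -sr !ltnNge; apply: contra => Tcb.
  have ne : b != c by apply: contraTneq rbc => ->; rewrite ltnn.
  apply/ltnW/inc; first by rewrite /read_lt rbc.
  by rewrite ltn_neqAle Tcb andbT (inj_eq val_inj) (inj_eq (@entry_inj _ _ T)) eq_sym.
rewrite /read_lt => /orP[rbc|/andP[/eqP rbc cbc] _]; last by rewrite sr; apply: rr.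
rewrite !ltnNge; apply: contra => sbc; apply/ltnW/inc => //.
rewrite -sr ltn_neqAle sbc andbT (inj_eq val_inj) (inj_eq (@entry_inj _ _ sink)).
by apply: contraTneq rbc => ->; rewrite ltnn.
Qed.

Lemma box_left c k : k <= col c -> exists2 b, row b = row c & col (alpha := alpha) b = k.
Proof.
move=> kc; have kr := leq_ltn_trans kc (ltn_ord (tagged c)).
by exists (Tagged (fun r : 'I_(size alpha) => 'I_(nth 0 alpha r)) (Ordinal kr)).
Qed.

Lemma SIT_interval T : SIT_pred T =
  (read_perm T \in weak_interval (read_perm (source alpha)) (read_perm (sit_sink alpha))).
Proof.
rewrite inE weak_le_source /SIT_pred; case Tr: (rows_increasing T) => //=.
have rr b c : row b = row c -> col b < col c -> sit_sink_lt b c.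
  by rewrite /sit_sink_lt => -> cc; rewrite eqxx cc; do !case: eqP; lia.
apply/first_column_increasingP/(weak_le_sinkP Tr ltn_entry_sit_sink rr) => inc b c.
  move=> rbc; rewrite /sit_sink_lt; case: eqP => [cb _|_ /andP[_]]; last by lia.
  (* Compare b with the first box d of the row of c, then d with c. *)
  have [d rd cd] := box_left (leq0n (col c)).
  have Tbd : entry T b < entry T d by apply: inc; rewrite ?rd.
  have [cc|cc] := posnP (col c); first by rewrite -(box_inj rd) ?cc.
  by apply: ltn_trans Tbd _; apply: (rows_increasingP T Tr); rewrite ?cd.
by move=> cb cc rbc; apply: inc; rewrite // /sit_sink_lt cb rbc orbT.
Qed.

(** The diagram is left-justified, so the row of [c] has a box in the column of
[b]: go down from [b] to that box, then right to [c]. *)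
Lemma SET_southeast T : SET_pred T ->
  forall b c, row b < row c -> col b <= col c -> entry T b < entry T c.
Proof.
move=> /andP[/rows_increasingP Tr /columns_increasingP Tc] b c rbc cbc.
have [d rd cd] := box_left cbc.
have Tbd : entry T b < entry T d by apply: Tc; rewrite ?rd.
move: cbc; rewrite leq_eqVlt => /orP[/eqP cbc|cbc].
  by rewrite -(box_inj rd) ?cd.
by apply: ltn_trans Tbd _; apply: Tr; rewrite ?cd.
Qed.

Lemma SET_interval T : SET_pred T =
  (read_perm T \in weak_interval (read_perm (source alpha)) (read_perm (set_sink alpha))).
Proof.
rewrite inE weak_le_source /SET_pred; case Tr: (rows_increasing T) => //=.
have rr b c : row b = row c -> col b < col c -> column_lt b c.
  by rewrite /column_lt => _ ->.
apply/idP/(weak_le_sinkP Tr ltn_entry_set_sink rr) => [Tc b c rbc|inc].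
  rewrite /column_lt => cbc; apply: SET_southeast => //; last by lia.
  by rewrite /SET_pred Tr.
apply/columns_increasingP => b c cbc rbc; apply: inc => //.
by rewrite /column_lt cbc rbc eqxx orbT.
Qed.

(** * Agreement of the actions *)

Section ReadingIso.
Variables (K : fieldType) (P : pred (filling alpha)) (s t : 'S_n).
Variable a : hecke_action n {T | P T}.
Hypothesis P_interval : forall T, P T = (read_perm T \in weak_interval s t).
Hypothesis a_descent : forall i (T : {T | P T}),
  a i T = if i \in DesL (read_perm (val T)) then Some T else insub (swap i (val T)).

Lemma unread_interval (g : {g | g \in weak_interval s t}) : P (unread (val g)).
Proof. by rewrite P_interval unreadK (valP g). Qed.

Lemma read_interval (T : {T | P T}) : read_perm (val T) \in weak_interval s t.
Proof. by rewrite -P_interval (valP T). Qed.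

Lemma reading_iso : hecke_iso (basis_mod K a) (B_mod K s t).
Proof.
apply: (@basis_bijection_iso _ _ _ _ _ _
  (fun T : {T | P T} => exist (fun g => g \in weak_interval s t) _ (read_interval T))
  (fun g : {g | g \in weak_interval s t} => exist (fun T => P T) _ (unread_interval g))).
- by move=> T; apply: val_inj; rewrite /= read_permK.
- by move=> g; apply: val_inj; rewrite /= unreadK.
move=> i T; apply: omap_val_inj; rewrite a_descent /b_action /= /b_fun /=.
case: ifP => // _; rewrite -read_perm_swap.
case: (boolP (P (swap i (val T)))) => PT.
  by rewrite (insubT P PT) insubT // -P_interval.
by rewrite !insubN // -P_interval.
Qed.

End ReadingIso.

Lemma pos_lo_hi_row i T : rows_increasing T ->
  row (pos T (lo i)) = row (pos T (hi i)) -> col (pos T (lo i)) < col (pos T (hi i)).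
Proof.
move=> /rows_increasingP Tr rr; case: ltngtP => // [cc|cc].
  by have := Tr _ _ (esym rr) cc; rewrite !posK /=; lia.
have /(congr1 (entry T)) := box_inj rr cc; rewrite !posK => /eqP.
by rewrite (negPf (lo_neq_hi i)).
Qed.

Lemma swap_pos_lt i T :
  (entry (swap i T) (pos T (lo i)) < entry (swap i T) (pos T (hi i))) = false.
Proof. by rewrite !entry_swap !posK tpermL tpermR /=; lia. Qed.

(** In one row [i] is left of [i + 1], hence read after it; so [i + 1] is read
first exactly when [i] is weakly below it. *)
Lemma sit_action_descent i (T : SIT alpha) : sit_action alpha i T =
  if i \in DesL (read_perm (val T)) then Some T else insub (swap i (val T)).
Proof.
rewrite sit_actionE /sit_fun in_DesL_read /read_lt.
have /andP[Tr _] := valP T; have := pos_lo_hi_row Tr (i := i).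
set p := pos _ _; set q := pos _ _.
case: (ltngtP (row p) (row q)) => /= [rr _|//|rr -> //].
case: ifP => // /andP[/eqP cp /eqP cq]; rewrite insubF //.
apply/negbTE/nandP; right; apply/negP => /first_column_increasingP/(_ _ _ cp cq).
by rewrite swap_pos_lt => /(_ rr).
Qed.

(** The boxes [p] of [i] and [q] of [i + 1] cannot be in arbitrary relative
position: [q] is not weakly northwest of [p], and if [q] is strictly below and
strictly right of [p], then the box in the row of [q] and the column of [p] would
have an entry strictly between [i] and [i + 1]. *)
Lemma set_action_descent i (T : SET alpha) : set_action alpha i T =
  if i \in DesL (read_perm (val T)) then Some T else insub (swap i (val T)).
Proof.
rewrite set_actionE /set_fun in_DesL_read /read_lt.
have TS := valP T; have /andP[Tr _] := TS; have := pos_lo_hi_row Tr (i := i).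
have southeast := SET_southeast TS; set p := pos _ _; set q := pos _ _ => pq_row.
have qp_cross : row q < row p -> col q <= col p -> False.
  by move=> rr cc; have := southeast _ _ rr cc; rewrite !posK /=; lia.
case: (ltngtP (col p)) => [cc|cc|cc].
- have [rr|//|//] := ltngtP (row p) (row q).
  have [d rd cd] := box_left (ltnW cc).
  have Tpd : entry (val T) p < entry (val T) d.
    by apply: southeast; rewrite ?rd ?cd.
  have Tdq : entry (val T) d < entry (val T) q.
    by apply: (rows_increasingP _ Tr); rewrite ?cd.
  by move: Tpd Tdq; rewrite !posK /=; lia.
- have [//|rr|rr] := ltngtP (row p) (row q); first by case: (qp_cross rr (ltnW cc)).
  by have := pq_row rr; lia.
have [rr|rr|rr] := ltngtP (row p) (row q).
- rewrite /= insubF //; apply/negbTE/nandP; right; apply/negP.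
  by move=> /columns_increasingP/(_ _ _ cc rr); rewrite swap_pos_lt.
- by case: (qp_cross rr); rewrite cc.
by have := pq_row rr; rewrite cc ltnn.
Qed.

End Listings.

Theorem theorem4p4 (R : realType) (n : nat) (alpha : composition n) :
  hecke_iso (V_mod R[i] alpha)
    (B_mod R[i] (read_perm (source alpha)) (read_perm (sit_sink alpha))) /\
  hecke_iso (X_mod R[i] alpha)
    (B_mod R[i] (read_perm (source alpha)) (read_perm (set_sink alpha))).
Proof.
split; apply: reading_iso.
- exact: SIT_interval.
- exact: sit_action_descent.
- exact: SET_interval.
- exact: set_action_descent.
Qed.
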